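(* Let $T \in \mathcal{B}(\mathcal{H})$. Then for any Orlicz function $\phi$, \[\phi\left(w^2(T)\right) \leq \frac{1}{2} \min \left\{ \phi\left(w\left(|T||T^*|\right)\right), \phi\left(w(T^2)\right)\right \} + \frac{1}{2}\, \phi \left( \frac12 \left\||T|^2 + |T^*|^2 \right\|\right).\]
   Context: $\mathcal{B}(\mathcal{H})$ is the algebra of bounded linear operators on a complex Hilbert space $\mathcal{H}$. For $T\in\mathcal{B}(\mathcal{H})$, $T^*$ is the adjoint, $|T|=(T^*T)^{1/2}$, $|T^*|=(TT^* )^{1/2}$, $\|T\|$ is the operator norm, $w(T)=\sup_{\|x\|=1}|\langle Tx,x\rangle|$ is the numerical radius, and $w^2(T)=(w(T))^2$. An Orlicz function is a continuous, convex, increasing function $\phi:[0,\infty)\to[0,\infty)$ with $\phi(0)=0$, $\phi(t)>0$ for all $t>0$, and $\lim_{t\to\infty}\phi(t)=\infty$. *)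

(* Defs.v *)
From HB Require Import structures.
From mathcomp Require Import all_boot all_order all_algebra.
From mathcomp Require Import complex.
From mathcomp Require Import all_classical all_reals all_analysis.

Set Implicit Arguments.
Unset Strict Implicit.
Unset Printing Implicit Defensive.

Import Order.TTheory GRing.Theory Num.Theory.
Import numFieldNormedType.Exports.

Local Open Scope classical_set_scope.
Local Open Scope ring_scope.
Local Open Scope complex_scope.

(* The norm of a normed R[i]-module takes its values in the nonnegative real
   elements of R[i]; this is the same number in R. *)
Definition rnorm (R : realType) (V : normedModType R[i]) (x : V) : R :=
  complex.Re `|x|.

(* The positive definite form ip (linear in its first argument, conjugate-linear
   in its second) makes the complete space H a complex Hilbert space: the norm,
   hence the topology, of H is the one induced by ip. *)
Definition hilbert_inner_product (R : realType) (H : completeNormedModType R[i])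
    (ip : {dot H for Num.conj}) : Prop :=
  forall x : H, `|x| ^+ 2 = ip x x.

Definition bounded_operator (R : realType) (H : normedModType R[i])
    (T : H -> H) : Prop :=
  linear T /\ exists M : R, forall x : H, rnorm (T x) <= M * rnorm x.

Definition positive_operator (R : realType) (H : normedModType R[i])
    (ip : {dot H for Num.conj}) (A : H -> H) : Prop :=
  bounded_operator A /\ forall x : H, 0 <= ip (A x) x.

(* For a bounded operator T of a Hilbert space such an S exists and is unique;
   the default value 0 of xget is then irrelevant. *)
Definition adjoint (R : realType) (H : normedModType R[i])
    (ip : {dot H for Num.conj}) (T : H -> H) : H -> H :=
  xget (fun=> 0) [set S : H -> H |
    bounded_operator S /\ forall x y : H, ip (T x) y = ip x (S y)].

(* The unique positive square root of a positive operator P; as above, the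
   default value is irrelevant for positive operators of a Hilbert space. *)
Definition sqrt_operator (R : realType) (H : normedModType R[i])
    (ip : {dot H for Num.conj}) (P : H -> H) : H -> H :=
  xget (fun=> 0) [set A : H -> H | positive_operator ip A /\ A \o A = P].

Definition abs_operator (R : realType) (H : normedModType R[i])
    (ip : {dot H for Num.conj}) (T : H -> H) : H -> H :=
  sqrt_operator ip (adjoint ip T \o T).

(* If H is the zero space, the supremum is over the empty set and equals 0. *)
Definition numerical_radius (R : realType) (H : normedModType R[i])
    (ip : {dot H for Num.conj}) (T : H -> H) : R :=
  sup [set complex.Re `|ip (T x) x| | x in [set x : H | rnorm x = 1]].

Definition operator_norm (R : realType) (H : normedModType R[i])
    (T : H -> H) : R :=
  sup [set rnorm (T x) | x in [set x : H | rnorm x <= 1]].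

(* Only the values of phi on [0, +oo[ matter. *)
Record orlicz_function (R : realType) (phi : R -> R) : Prop := OrliczFunction {
  orlicz_ge0 : forall t : R, 0 <= t -> 0 <= phi t ;
  orlicz_continuous : {within `[0, +oo[%classic, continuous phi} ;
  orlicz_convex : convex_function (`[0, +oo[%classic : set R) phi ;
  orlicz_increasing : {in `[0, +oo[ &, {homo phi : s t / s <= t}} ;
  orlicz0 : phi 0 = 0 ;
  orlicz_gt0 : forall t : R, 0 < t -> 0 < phi t ;
  orlicz_pinfty : phi t @[t --> +oo] --> +oo
}.

(* Main.v *)
(* For a unit vector [x], Buzano's inequality
   [2 |<a, x> <x, b>| <= |a| |b| + |<a, b>|] with [a = T x], [b = T^* x] bounds
   [2 |<T x, x>|^2] by [|T x| |T^* x| + |<T^2 x, x>|]. With [a = |T| x] and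
   [b = |T^*| x] it gives [|T x| |T^* x| + |<|T| |T^*| x, x>|], once combined
   with the mixed Schwarz inequality [|<T x, x>|^2 <= <|T| x, x> <|T^*| x, x>].
   By AM-GM, [|T x| |T^* x| <= <(|T|^2 + |T^*|^2) x, x> / 2]; the monotonicity
   and convexity of [phi] conclude.

   The operator theory is obtained by elementary means: a square root of
   [M (1 - Q)], with [Q] a self-adjoint contraction, is [sqrt M (1 - Y)] with
   [Y = lim Y_n] and [Y_(n+1) = (Q + Y_n^2) / 2]; since [Y_n] and
   [Y_(n+1) - Y_n] are polynomials in [Q] with nonnegative coefficients,
   evaluating them at [1] bounds their norms. *)
Require Import Defs.
From HB Require Import structures.
From mathcomp Require Import all_boot all_order all_algebra.
From mathcomp Require Import complex ring lra.
From mathcomp Require Import all_classical all_reals all_analysis.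
Set Implicit Arguments.
Unset Strict Implicit.
Unset Printing Implicit Defensive.
Import Order.TTheory GRing.Theory Num.Theory.
Import numFieldNormedType.Exports.
Local Open Scope ring_scope.
Local Open Scope complex_scope.

Lemma linear_add (R : pzRingType) (U V : lmodType R) (T : U -> V) :
  linear T -> {morph T : x y / x + y}.
Proof. by move=> hT x y; have := hT 1 x y; rewrite !scale1r. Qed.

(** * Real-valued norm and real part of the inner product *)

Section InnerProduct.
Variables (R : realType) (H : completeNormedModType R[i]).
Variable ip : {dot H for Num.conj}.
Hypothesis hip : hilbert_inner_product ip.
Implicit Types (x y z : H) (a : R) (c : R[i]).

(** The real part is a symmetric real-bilinear form, so estimates stay in the ordered field [R].
    Complex statements are recovered through [rip_ip] and [ip_rotate]. *)
Definition re_ip x y : R := complex.Re (ip x y).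
Local Notation rip := re_ip.

Lemma rnormE x : `|x| = (rnorm x)%:C.
Proof. by rewrite /rnorm RRe_real ?normr_real. Qed.

Lemma rnorm_ge0 x : 0 <= rnorm x.
Proof. by rewrite -lecR -rnormE normr_ge0. Qed.

Lemma rnorm0 : rnorm (0 : H) = 0.
Proof. by rewrite /rnorm normr0. Qed.

Lemma rnorm0_eq0 x : rnorm x = 0 -> x = 0.
Proof. by move=> x0; apply/normr0_eq0; rewrite rnormE x0. Qed.

Lemma rnormN x : rnorm (- x) = rnorm x.
Proof. by rewrite /rnorm normrN. Qed.

Lemma rnormB x y : rnorm (x - y) = rnorm (y - x).
Proof. by rewrite /rnorm distrC. Qed.

Lemma ler_rnormD x y : rnorm (x + y) <= rnorm x + rnorm y.
Proof. by rewrite -lecR rmorphD /= -!rnormE ler_normD. Qed.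

Lemma rnormZ c x : rnorm (c *: x) = complex.Re `|c| * rnorm x.
Proof.
rewrite {1}/rnorm normrZ rnormE.
by case: `|c| => u v /=; rewrite mulr0 subr0.
Qed.

Lemma rnormZr a x : 0 <= a -> rnorm (a%:C *: x) = a * rnorm x.
Proof. by move=> a0; rewrite rnormZ ger0_norm // ler0c. Qed.

Lemma ipDl x y z : ip (x + y) z = ip x z + ip y z.
Proof. exact: linearDl. Qed.
Lemma ipDr x y z : ip x (y + z) = ip x y + ip x z.
Proof. exact: linearDr. Qed.
Lemma ipNl x y : ip (- x) y = - ip x y.
Proof. exact: linearNl. Qed.
Lemma ipNr x y : ip x (- y) = - ip x y.
Proof. exact: linearNr. Qed.
Lemma ipZl c x y : ip (c *: x) y = c * ip x y.
Proof. exact: linearZl_LR. Qed.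
Lemma ipZr c x y : ip x (c *: y) = (c^*)%C * ip x y.
Proof. exact: linearZr_LR. Qed.
Lemma ipC x y : ip x y = ((ip y x)^*)%C.
Proof. by rewrite hermC expr0 mul1r. Qed.

Lemma ripDl x y z : rip (x + y) z = rip x z + rip y z.
Proof. by rewrite /re_ip ipDl; case: (ip x z) (ip y z) => ? ? []. Qed.
Lemma ripDr x y z : rip x (y + z) = rip x y + rip x z.
Proof. by rewrite /re_ip ipDr; case: (ip x y) (ip x z) => ? ? []. Qed.
Lemma ripNl x y : rip (- x) y = - rip x y.
Proof. by rewrite /re_ip ipNl; case: (ip x y). Qed.
Lemma ripNr x y : rip x (- y) = - rip x y.
Proof. by rewrite /re_ip ipNr; case: (ip x y). Qed.
Lemma ripBl x y z : rip (x - y) z = rip x z - rip y z.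
Proof. by rewrite ripDl ripNl. Qed.
Lemma ripBr x y z : rip x (y - z) = rip x y - rip x z.
Proof. by rewrite ripDr ripNr. Qed.
Lemma ripZl a x y : rip (a%:C *: x) y = a * rip x y.
Proof. by rewrite /re_ip ipZl; case: (ip x y) => u v /=; rewrite mul0r subr0. Qed.
Lemma ripC x y : rip x y = rip y x.
Proof. by rewrite /re_ip ipC; case: (ip y x). Qed.
Lemma ripZr a x y : rip x (a%:C *: y) = a * rip x y.
Proof. by rewrite ripC ripZl ripC. Qed.
Lemma rip0l x : rip 0 x = 0.
Proof. by rewrite -(scale0r 0) -[0 in LHS]/(0%:C) ripZl mul0r. Qed.
Lemma rip0r x : rip x 0 = 0.
Proof. by rewrite ripC rip0l. Qed.

Lemma ip_rnorm x : ip x x = (rnorm x ^+ 2)%:C.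
Proof. by rewrite -hip rnormE rmorphXn. Qed.

Lemma ripxx x : rip x x = rnorm x ^+ 2.
Proof. by rewrite /re_ip ip_rnorm. Qed.

Lemma ip_ext x y : (forall z, rip z x = rip z y) -> x = y.
Proof.
move=> xy; apply/subr0_eq/rnorm0_eq0/eqP; rewrite -sqrf_eq0 -ripxx.
by rewrite ripBr xy subrr.
Qed.

Lemma rnormD2 x y : rnorm (x + y) ^+ 2 =
  rnorm x ^+ 2 + 2 * rip x y + rnorm y ^+ 2.
Proof. by rewrite -!ripxx ripDl !ripDr (ripC y x); lra. Qed.

(* [Im w = Re (- i w)], so a complex adjunction reduces to a real one. *)
Lemma rip_ip (S T : H -> H) : linear S ->
  (forall x y, rip (S x) y = rip x (T y)) -> forall x y, ip (S x) y = ip x (T y).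
Proof.
move=> hS hST x y; have := hST ('i *: x) y; have := hST x y.
rewrite /re_ip (scalable_linear hS) /= !ipZl.
by case: (ip _ _) (ip _ _) => a b [c d] /= -> /eqP; rewrite !mul0r !sub0r !mul1r
  eqr_opp => /eqP ->.
Qed.

End InnerProduct.

(** A quadratic polynomial that is nonnegative on the real line has a nonpositive discriminant. This
    serves all the Cauchy-Schwarz arguments and the first variation in [riesz_on_subspace]. *)
Lemma discr_le (R : realType) (a b c : R) : 0 <= a -> 0 <= c ->
  (forall t : R, 0 <= a + 2 * t * b + t ^+ 2 * c) -> b ^+ 2 <= a * c.
Proof.
move=> a0 c0 h; have [c1|c1] := eqVneq c 0.
  subst c; have [->|b0] := eqVneq b 0; first by rewrite expr0n mulr0.
  (* At this [t] the affine function [a + 2 * t * b] equals [-1]. *)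
  have := h (- (a + 1) / (2 * b)); rewrite mulr0 addr0.
  have -> : 2 * (- (a + 1) / (2 * b)) * b = - (a + 1) by field.
  lra.
have cp : 0 < c by rewrite lt_neqAle eq_sym c1.
(* This is the minimizer of the quadratic. *)
have := h (- b / c).
have -> : a + 2 * (- b / c) * b + (- b / c) ^+ 2 * c = (a * c - b ^+ 2) / c
  by field.
by rewrite pmulr_lge0 ?invr_gt0 // subr_ge0.
Qed.

(** * Cauchy-Schwarz inequality *)

Section CauchySchwarz.
Variables (R : realType) (H : completeNormedModType R[i]).
Variable ip : {dot H for Num.conj}.
Hypothesis hip : hilbert_inner_product ip.
Implicit Types (x y z : H) (a : R) (c : R[i]).
Local Notation rip := (re_ip ip).

Lemma rip_CS x y : `|rip x y| <= rnorm x * rnorm y.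
Proof.
rewrite -ler_sqr ?nnegrE ?normr_ge0 ?mulr_ge0 ?rnorm_ge0 //.
rewrite real_normK ?num_real // exprMn.
apply: discr_le => [||t]; rewrite ?sqr_ge0 //.
have := sqr_ge0 (rnorm (x + t%:C *: y)).
rewrite (rnormD2 hip) ripZr -(ripxx hip (t%:C *: y)) ripZl ripZr (ripxx hip).
by congr (_ <= _); ring.
Qed.

Lemma rip_le x y : rip x y <= rnorm x * rnorm y.
Proof. exact: le_trans (ler_norm _) (rip_CS x y). Qed.

(** A unimodular factor turns the inner product into its modulus, so a bound on real parts that is
    invariant under rotation of [x] yields a bound on moduli. *)
Lemma ip_rotate x y : exists c : R[i], `|c| = 1 /\
  complex.Re `|ip x y| = rip (c *: x) y.
Proof.
have [w0|w0] := eqVneq (ip x y) 0.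
  by exists 1; rewrite normr1 scale1r /re_ip w0 normr0.
exists ((ip x y)^*%C / `|ip x y|); split.
  by rewrite normrM normfV normr_id normcJ divff ?normr_eq0.
rewrite /re_ip ipZl mulrAC [_ * ip x y]mulrC -sqr_normc expr2 mulfK //.
by rewrite normr_eq0.
Qed.

Lemma rnorm_rotate (c : R[i]) x : `|c| = 1 -> rnorm (c *: x) = rnorm x.
Proof. by move=> c1; rewrite rnormZ c1 mul1r. Qed.

Lemma ip_CS x y : complex.Re `|ip x y| <= rnorm x * rnorm y.
Proof.
have [c [c1 ->]] := ip_rotate x y.
by rewrite -(rnorm_rotate x c1) rip_le.
Qed.
End CauchySchwarz.

(** * Completeness and Riesz representation *)

Section Completeness.
Variables (R : realType) (H : completeNormedModType R[i]).
Implicit Types u : nat -> H.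

Definition converges_to u (l : H) := forall e : R, 0 < e ->
  exists N, forall n, (N <= n)%N -> rnorm (u n - l) < e.

Lemma cauchy_converges u :
  (forall e : R, 0 < e -> exists N, forall m n, (N <= m)%N -> (N <= n)%N ->
    rnorm (u m - u n) < e) ->
  exists l, converges_to u l.
Proof.
move=> hu.
have hc : cvgn u.
  apply: cauchy_cvg; apply: cauchy_exP => e e0.
  (* Radii in [R[i]] are positive, hence real. *)
  have er : (complex.Re e)%:C = e by rewrite RRe_real // gtr0_real.
  have e1 : 0 < complex.Re e by rewrite -ltcR er.
  have [N hN] := hu _ e1; exists (u N); exists N => // n Nn.
  by rewrite /= -ball_normE /= rnormE -er ltcR; exact: hN.
exists (limn u) => e e0.
have ec0 : 0 < e%:C by rewrite ltcR.
have /cvgrPdist_lt /(_ _ ec0) [N _ hN] := hc.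
exists N => n Nn; rewrite -ltcR -rnormE -normrN opprB; exact: hN.
Qed.

End Completeness.

Section Variational.
Variables (R : realType) (H : completeNormedModType R[i]).
Variable ip : {dot H for Num.conj}.
Hypothesis hip : hilbert_inner_product ip.
Local Notation rip := (re_ip ip).

(* Both the Riesz representation and the projection onto the closure of [V]
   are instances: minimize [rnorm v ^+ 2 - 2 * f v] over [V]; a minimizing
   sequence is Cauchy by the parallelogram law. *)
Lemma riesz_on_subspace (V : H -> Prop) (f : H -> R) (M : R) :
  V 0 -> (forall x y, V x -> V y -> V (x + y)) ->
  (forall (a : R) x, V x -> V (a%:C *: x)) ->
  (forall x y, f (x + y) = f x + f y) ->
  (forall (a : R) x, f (a%:C *: x) = a * f x) ->
  (forall x, `|f x| <= M * rnorm x) ->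
  exists (u : nat -> H) (z : H), [/\ forall n, V (u n), converges_to u z &
    forall v, V v -> rip z v = f v].
Proof.
move=> V0 VD VZ fD fZ fM.
pose q v := rnorm v ^+ 2 - 2 * f v.
pose E := [set - q v | v in [set v | V v]]%classic.
have Esup : has_sup E.
  split; first by exists (- q 0); exists 0.
  (* [2 * f v - |v|^2 <= 2 M |v| - |v|^2 <= M^2], where [|v|] is [rnorm v]. *)
  exists (M ^+ 2) => _ [v _ <-]; rewrite /q.
  have := fM v; have := ler_norm (f v); have := sqr_ge0 (M - rnorm v).
  rewrite sqrrB; lra.
pose m := - sup E.
have qm v : V v -> m <= q v.
  by move=> Vv; rewrite lerNl; apply: sup_upper_bound => //; exists v.
have hex n : exists v, V v /\ q v < m + n.+1%:R^-1.
  have n0 : 0 < n.+1%:R^-1 :> R by rewrite invr_gt0.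
  have [_ [v Vv <-] hv] := sup_adherent n0 Esup.
  exists v; split=> //; rewrite /m; move: (_^-1) (sup E) hv => a b; lra.
have [u hu] := choice hex; exists u.
(* The parallelogram law gives [|v - w|^2 = 2 q(v) + 2 q(w) - 4 q((v + w) / 2)], and the midpoint
   lies in [V]. *)
have mid v w : V v -> V w -> rnorm (v - w) ^+ 2 <= 2 * (q v - m) + 2 * (q w - m).
  move=> Vv Vw; have /qm : V ((2^-1)%:C *: (v + w)) by apply/VZ/VD.
  rewrite /q rnormZr ?invr_ge0 // fZ fD exprMn (rnormD2 hip v w).
  rewrite (rnormD2 hip v (- w)) rnormN ripNr; lra.
have hc e : 0 < e -> exists N, forall m n, (N <= m)%N -> (N <= n)%N ->
    rnorm (u m - u n) < e.
  move=> e0; have e4 : 0 < e ^+ 2 / 4 by rewrite divr_gt0 ?exprn_gt0.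
  have [N hN] : exists N, forall n, (N <= n)%N -> n.+1%:R^-1 < e ^+ 2 / 4.
    have [N _ hN] := near_infty_natSinv_lt (PosNum e4).
    by exists N => n; exact: hN.
  exists N => i j Ni Nj; rewrite -(@ltr_pXn2r _ 2) ?nnegrE ?rnorm_ge0 ?ltW //.
  have := mid _ _ (hu i).1 (hu j).1; have := (hu i).2; have := (hu j).2.
  have := hN _ Ni; have := hN _ Nj.
  move: (i.+1%:R^-1 : R) (j.+1%:R^-1 : R) => a b; lra.
have [z hz] := cauchy_converges hc; exists z; split=> // [n|v Vv].
  exact: (hu n).1.
(* First variation: [q (u n + t v) >= m > q (u n) - 1 / (n + 1)] for all real [t], so a quadratic in
   [t] is nonnegative. *)
have hn n : (rip (u n) v - f v) ^+ 2 <= n.+1%:R^-1 * rnorm v ^+ 2.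
  apply: discr_le; rewrite ?invr_ge0 ?sqr_ge0 // => t.
  have := qm _ (VD _ _ (hu n).1 (VZ t _ Vv)); have := (hu n).2.
  rewrite /q (rnormD2 hip) -(ripxx hip (t%:C *: v)) !ripZr ripZl (ripxx hip).
  rewrite fD fZ; move: (n.+1%:R^-1 : R) => a; lra.
suff hlim e : 0 < e -> `|rip z v - f v| <= e.
  apply/eqP; rewrite -subr_eq0 -normr_le0; apply/ler_addgt0Pr => e e0.
  by rewrite add0r; exact: hlim.
move=> e0; have v1 : 0 < 2 * (rnorm v + 1).
  by rewrite mulr_gt0 // ltr_wpDl ?rnorm_ge0.
(* Two errors of at most [d * rnorm v] each will add up to less than [e]. *)
have [d [d0 dE]] : exists d, 0 < d /\ d * (2 * (rnorm v + 1)) = e.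
  exists (e / (2 * (rnorm v + 1))).
  by rewrite divr_gt0 // mulfVK // gt_eqF.
have [N hN] := hz _ d0.
have d2 : 0 < d ^+ 2 by rewrite exprn_gt0.
have [N' _ hN'] := near_infty_natSinv_lt (PosNum d2).
pose n := maxn N N'; have := hN n (leq_maxl _ _) => h1.
have := hN' n (leq_maxr _ _) => /= h2.
have h3 : `|rip (u n) v - f v| <= d * rnorm v.
  rewrite -ler_sqr ?nnegrE ?normr_ge0 ?mulr_ge0 ?rnorm_ge0 ?(ltW d0) //.
  rewrite real_normK ?num_real // exprMn; apply: le_trans (hn n) _.
  by rewrite ler_wpM2r ?sqr_ge0 // ltW.
have h4 : `|rip (u n - z) v| <= d * rnorm v.
  apply: le_trans (rip_CS hip _ _) _.
  by rewrite ler_wpM2r ?rnorm_ge0 // ltW.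
have -> : rip z v - f v = (rip (u n) v - f v) - rip (u n - z) v.
  by rewrite ripBl; lra.
apply: le_trans (ler_normB _ _) _.
lra.
Qed.
End Variational.

(** * Bounded operators, adjoints and positive operators *)

Section LinearMaps.
Variables (R : pzRingType) (H : lmodType R).
Implicit Types S T : H -> H.

Lemma linear_comp S T : linear S -> linear T -> linear (S \o T).
Proof. by move=> hS hT a x y /=; rewrite hT hS. Qed.

Lemma linear_addf S T : linear S -> linear T -> linear (fun x => S x + T x).
Proof. by move=> hS hT a x y /=; rewrite hT hS scalerDr addrACA. Qed.

Lemma linear_oppf T : linear T -> linear (fun x => - T x).
Proof. by move=> hT a x y /=; rewrite hT opprD scalerN. Qed.

Lemma linear_subf S T : linear S -> linear T -> linear (fun x => S x - T x).
Proof. by move=> hS hT; apply: linear_addf => //; exact: linear_oppf. Qed.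

Lemma linear_sub T : linear T -> {morph T : x y / x - y}.
Proof. by move=> hT x y; rewrite (zmod_morphism_linear hT). Qed.

Lemma linear_apply0 T : linear T -> T 0 = 0.
Proof. by move=> hT; have := linear_sub hT 0 0; rewrite !subrr. Qed.

Lemma linear_applyN T x : linear T -> T (- x) = - T x.
Proof. by move=> hT; rewrite -sub0r linear_sub // linear_apply0 ?sub0r. Qed.
End LinearMaps.

Section Operators.
Variables (R : realType) (H : completeNormedModType R[i]).
Variable ip : {dot H for Num.conj}.
Hypothesis hip : hilbert_inner_product ip.
Implicit Types (x y z : H) (a : R) (S T A B : H -> H).
Local Notation rip := (re_ip ip).

Lemma linear_scalef c T : linear T -> linear (fun x => c *: T x : H).
Proof. by move=> hT a x y /=; rewrite hT scalerDr !scalerA mulrC. Qed.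

Lemma bounded_operator_pos T : bounded_operator T ->
  exists M : R, 0 < M /\ forall x, rnorm (T x) <= M * rnorm x.
Proof.
case=> _ [M hM]; exists (`|M| + 1); split; first by rewrite ltr_wpDl.
move=> x; apply: le_trans (hM x) _; apply: ler_wpM2r; first exact: rnorm_ge0.
by rewrite ler_wpDr // ler_norm.
Qed.

Lemma bounded_comp S T :
  bounded_operator S -> bounded_operator T -> bounded_operator (S \o T).
Proof.
move=> bS bT; split; first by apply: linear_comp; [case: bS|case: bT].
have [M [M0 hM]] := bounded_operator_pos bS.
have [N [N0 hN]] := bounded_operator_pos bT.
exists (M * N) => x /=; apply: le_trans (hM _) _.
by rewrite -mulrA ler_wpM2l // ltW.
Qed.

Lemma bounded_addf S T : bounded_operator S -> bounded_operator T ->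
  bounded_operator (fun x => S x + T x).
Proof.
move=> [lS [M hM]] [lT [N hN]]; split; first exact: linear_addf.
by exists (M + N) => x; rewrite mulrDl (le_trans (ler_rnormD _ _)) // lerD.
Qed.

Lemma bounded_oppf T : bounded_operator T -> bounded_operator (fun x => - T x).
Proof.
move=> [lT [M hM]]; split; first exact: linear_oppf.
by exists M => x; rewrite rnormN.
Qed.

(** A relational adjoint, independent of the choice made in [adjoint]; [adjoint_pair A A] expresses
    self-adjointness. *)
Definition adjoint_pair T S := forall x y, ip (T x) y = ip x (S y).

Lemma adjoint_pairC T S : adjoint_pair T S -> adjoint_pair S T.
Proof. by move=> h x y; rewrite ipC -h -ipC. Qed.

Lemma adjoint_pair_rip T S x y : adjoint_pair T S -> rip (T x) y = rip x (S y).
Proof. by rewrite /re_ip => ->. Qed.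

Lemma ip_extC x y : (forall z, ip z x = ip z y) -> x = y.
Proof. by move=> h; apply: (ip_ext hip) => z; rewrite /re_ip h. Qed.

Lemma adjoint_pair_linear T S : adjoint_pair T S -> linear S.
Proof.
move=> h a x y; apply: ip_extC => z.
by rewrite -h !ipDr !ipZr !h.
Qed.

(** [|S y|^2 = <T S y, y> <= M |S y| |y|], then divide by [|S y|]. *)
Lemma adjoint_pair_bounded T S :
  adjoint_pair T S -> bounded_operator T -> bounded_operator S.
Proof.
move=> h bT; split; first exact: adjoint_pair_linear h.
have [M [M0 hM]] := bounded_operator_pos bT; exists M => y.
have [->|] := eqVneq (rnorm (S y)) 0; first by rewrite mulr_ge0 ?rnorm_ge0 ?ltW.
rewrite eq_sym => s0; have {}s0 : 0 < rnorm (S y) by rewrite lt_neqAle s0 rnorm_ge0.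
rewrite -(ler_pM2l s0) -expr2 -(ripxx hip) -(adjoint_pair_rip _ _ h).
apply: le_trans (rip_le hip _ _) _.
by rewrite mulrA (mulrC _ M) ler_wpM2r ?rnorm_ge0.
Qed.

(** Riesz representation on the whole space of the real functional [x |-> rip (T x) y]; [rip_ip]
    upgrades the resulting real adjunction to a complex one. *)
Lemma adjoint_exists T : bounded_operator T ->
  exists S, bounded_operator S /\ adjoint_pair T S.
Proof.
move=> bT; have [M [M0 hM]] := bounded_operator_pos bT; have lT := bT.1.
have hex y : exists z, forall x, rip (T x) y = rip x z.
  have [||x x'|a x|x|_ [z [_ _ hz]]] := @riesz_on_subspace _ _ ip hip (fun=> True)
    (fun x => rip (T x) y) (M * rnorm y) I => //.
  - by rewrite (linear_add lT) ripDl.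
  - by rewrite (scalable_linear lT) ripZl.
  - apply: le_trans (rip_CS hip _ _) _.
    by rewrite mulrAC ler_wpM2r ?rnorm_ge0.
  by exists z => x; rewrite [RHS]ripC hz.
have [S hS] := choice hex; exists S.
have h : adjoint_pair T S by apply: rip_ip => // x y; exact: hS.
by split => //; exact: adjoint_pair_bounded h bT.
Qed.

Lemma adjointP T : bounded_operator T ->
  bounded_operator (adjoint ip T) /\ adjoint_pair T (adjoint ip T).
Proof.
move=> /adjoint_exists [S hS]; rewrite /adjoint; case: xgetP => [S' -> //|].
by move=> /(_ S) /(_ hS).
Qed.

(** Polarization: [<A z, z>] is real for [z = x], [y] and [x + i y], and its imaginary part at
    [x + i y] is [Re <A y, x> - Re <A x, y>]. *)
Lemma positive_selfadjoint A : positive_operator ip A -> adjoint_pair A A.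
Proof.
move=> [[lA _] pA]; apply: rip_ip => // x y.
have re0 z : complex.Im (ip (A z) z) = 0 by exact: ger0_Im.
have := re0 (x + 'i *: y); have := re0 x; have := re0 y.
rewrite (linear_add lA) (scalable_linear lA) /= !(ipDl, ipDr, ipZl, ipZr).
rewrite /re_ip [ip x (A y)]ipC.
case: (ip (A x) x) (ip (A y) y) (ip (A x) y) (ip (A y) x)
  => [? ?] [? ?] [? ?] [? ?] /=; lra.
Qed.

Lemma positive_rip_ge0 A x : positive_operator ip A -> 0 <= rip (A x) x.
Proof. by move=> [_ /(_ x)]; rewrite lecE => /andP[]. Qed.

Lemma selfadjoint_rip_ge0_positive A : bounded_operator A -> adjoint_pair A A ->
  (forall x, 0 <= rip (A x) x) -> positive_operator ip A.
Proof.
move=> bA sA pA; split=> // x; rewrite lecE /= pA andbT.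
have := sA x x; rewrite [RHS]ipC; case: (ip _ _) => u v [] /= h.
by apply/eqP; lra.
Qed.

Lemma positive_CS A x y : positive_operator ip A ->
  rip (A x) y ^+ 2 <= rip (A x) x * rip (A y) y.
Proof.
move=> pA; apply: discr_le; rewrite ?positive_rip_ge0 // => t.
have lA := pA.1.1.
have := positive_rip_ge0 (x + t%:C *: y) pA.
rewrite (linear_add lA) (scalable_linear lA) !(ripDl, ripDr, ripZl, ripZr).
rewrite (adjoint_pair_rip y x (positive_selfadjoint pA)) [rip y (A x)]ripC.
by congr (_ <= _); ring.
Qed.

(** This is [A^2 <= M A]. Cauchy-Schwarz for the form [<A x, y>] at [y = A x] gives [|A x|^4 <= <A
    x, x> <A A x, A x> <= <A x, x> M |A x|^2]. *)
Lemma positive_norm_le A (M : R) x : positive_operator ip A -> 0 < M ->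
  (forall x, rnorm (A x) <= M * rnorm x) ->
  rnorm (A x) ^+ 2 <= M * rip (A x) x.
Proof.
move=> pA M0 hM; have := positive_CS x (A x) pA; rewrite (ripxx hip).
have h : rip (A (A x)) (A x) <= M * rnorm (A x) ^+ 2.
  apply: le_trans (rip_le hip _ _) _.
  by rewrite expr2 mulrA ler_wpM2r ?rnorm_ge0.
have p := positive_rip_ge0 x pA.
have [->|n0] := eqVneq (rnorm (A x)) 0.
  by rewrite expr0n mulr_ge0 // ltW.
have {n0} n0 : 0 < rnorm (A x) ^+ 2.
  by rewrite exprn_gt0 // lt_neqAle eq_sym n0 rnorm_ge0.
move=> /le_trans /(_ (ler_wpM2l p h)).
by rewrite [in X in _ -> X]mulrC mulrA expr2 ler_pM2r.
Qed.
End Operators.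

(** * Iteration towards the square root *)

Lemma le_small_eq0 (R : realFieldType) (a K : R) : 0 <= a -> 0 <= K ->
  (forall e, 0 < e -> a <= e * K) -> a = 0.
Proof.
move=> a0 K0 h; apply/eqP; rewrite eq_le a0 andbT; apply/ler_addgt0Pr => e e0.
rewrite add0r; have K1 : 0 < K + 1 by rewrite ltr_wpDl.
apply: le_trans (h _ (divr_gt0 e0 K1)) _.
by rewrite mulrAC ler_pdivrMr // ler_wpM2l ?ltW // ltrDl.
Qed.

Section SquareRoot.
Variables (R : realType) (H : completeNormedModType R[i]).
Variable ip : {dot H for Num.conj}.
Hypothesis hip : hilbert_inner_product ip.
Implicit Types (x y z : H) (a r s : R) (S T A B Q Y Z : H -> H).
Local Notation rip := (re_ip ip).
Local Notation adjoint_pair := (adjoint_pair ip).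

Lemma rnorm_small_eq0 x K : 0 <= K ->
  (forall e, 0 < e -> rnorm x <= e * K) -> x = 0.
Proof. by move=> K0 h; apply/rnorm0_eq0/(le_small_eq0 _ K0 h)/rnorm_ge0. Qed.

(* Meant for [Y = p(Q)] with [p] a polynomial (or a power series) with
   nonnegative coefficients and [r = p(1)]. *)
Definition dominated Q Y r := [/\ linear Y, 0 <= r,
  (forall x, rnorm (Y x) <= r * rnorm x), adjoint_pair Y Y &
  forall Z, bounded_operator Z -> (forall x, Z (Q x) = Q (Z x)) ->
    forall x, Z (Y x) = Y (Z x)].

Lemma dominated_bounded Q Y r : dominated Q Y r -> bounded_operator Y.
Proof. by case=> lY _ bY _ _; split=> //; exists r. Qed.

Lemma dominated_ext Q Y Y' r r' : (forall x, Y x = Y' x) -> r = r' ->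
  dominated Q Y r -> dominated Q Y' r'.
Proof. by move=> /funext -> ->. Qed.

Lemma dominated0 Q : linear Q -> dominated Q (fun=> 0) 0.
Proof.
move=> lQ; split=> //.
- by move=> a x y; rewrite scaler0 addr0.
- by move=> x; rewrite rnorm0 mul0r.
- by move=> x y; rewrite linear0l linear0r.
- by move=> Z [lZ _] _ x; rewrite linear_apply0.
Qed.

Lemma dominatedX Q : linear Q -> (forall x, rnorm (Q x) <= rnorm x) ->
  adjoint_pair Q Q -> dominated Q Q 1.
Proof. by move=> lQ bQ sQ; split=> // x; rewrite mul1r. Qed.

Lemma dominatedD Q Y Z r s : dominated Q Y r -> dominated Q Z s ->
  dominated Q (fun x => Y x + Z x) (r + s).
Proof.
move=> [lY r0 bY sY cY] [lZ s0 bZ sZ cZ]; split.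
- exact: linear_addf.
- exact: addr_ge0.
- by move=> x; rewrite mulrDl (le_trans (ler_rnormD _ _)) // lerD.
- by move=> x y; rewrite ipDl ipDr sY sZ.
- by move=> W bW cW x; rewrite (linear_add bW.1) cY // cZ.
Qed.

Lemma dominatedZ Q Y r a : 0 <= a -> dominated Q Y r ->
  dominated Q (fun x => a%:C *: Y x) (a * r).
Proof.
move=> a0 [lY r0 bY sY cY]; split.
- exact: linear_scalef.
- exact: mulr_ge0.
- by move=> x; rewrite rnormZr // -mulrA ler_wpM2l.
- by move=> x y; rewrite ipZl ipZr sY conjc_real.
- by move=> W bW cW x; rewrite (scalable_linear bW.1) /= cY.
Qed.

(** The commutation clause is used twice: [Q] commutes with itself, hence with [Y]; so [Y] commutes
    with [Q], hence with [Z]. *)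
Lemma dominated_comm Q Y Z r s : bounded_operator Q ->
  dominated Q Y r -> dominated Q Z s -> forall x, Y (Z x) = Z (Y x).
Proof.
move=> bQ dY dZ; case: (dY) (dZ) => [_ _ _ _ cY] [_ _ _ _ cZ].
by apply: cZ; [exact: dominated_bounded dY|move=> x; rewrite cY].
Qed.

Lemma dominatedM Q Y Z r s : bounded_operator Q ->
  dominated Q Y r -> dominated Q Z s -> dominated Q (Y \o Z) (r * s).
Proof.
move=> bQ dY dZ; case: (dY) (dZ) => [lY r0 bY sY cY] [lZ s0 bZ sZ cZ].
split.
- exact: linear_comp.
- exact: mulr_ge0.
- by move=> x /=; rewrite (le_trans (bY _)) // -mulrA ler_wpM2l.
- by move=> x y /=; rewrite sY sZ (dominated_comm bQ dY dZ).
- by move=> W bW cW x /=; rewrite cY // cZ.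
Qed.

(** Each clause holds for [Yn n]; replacing [Y] by [Yn n] costs at most [e] times a constant
    independent of [n]. *)
Lemma dominated_lim Q Y (Yn : nat -> H -> H) (rn : nat -> R) r :
  (forall n, dominated Q (Yn n) (rn n)) -> (forall n, rn n <= r) ->
  (forall e, 0 < e -> exists n, forall x, rnorm (Y x - Yn n x) <= e * rnorm x) ->
  dominated Q Y r.
Proof.
move=> dn rnr hlim; have r0 : 0 <= r.
  by have [_ h _ _ _] := dn 0; exact: le_trans h (rnr 0).
have bY x : rnorm (Y x) <= r * rnorm x.
  apply/ler_addgt0Pr => e e0.
  have K1 : 0 < rnorm x + 1 by rewrite ltr_wpDl ?rnorm_ge0.
  have [n hn] := hlim _ (divr_gt0 e0 K1).
  have -> : Y x = Yn n x + (Y x - Yn n x) by rewrite addrC subrK.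
  apply: le_trans (ler_rnormD _ _) _; apply: lerD.
    have [_ _ h _ _] := dn n; rewrite (le_trans (h x)) // ler_wpM2r ?rnorm_ge0 //.
  apply: le_trans (hn x) _; rewrite mulrAC ler_pdivrMr // ler_wpM2l ?ltW //.
  by rewrite ltrDl.
have lY : linear Y.
  move=> c x y; apply/subr0_eq; pose K := rnorm (c *: x + y) +
    complex.Re `|c| * rnorm x + rnorm y.
  have c0 : 0 <= complex.Re `|c| by have := normr_ge0 c; rewrite lecE => /andP[].
  apply: (@rnorm_small_eq0 _ K) => [|e e0].
    by rewrite /K !addr_ge0 ?mulr_ge0 ?rnorm_ge0.
  have [n hn] := hlim _ e0; have [ln _ _ _ _] := dn n.
  have -> : Y (c *: x + y) - (c *: Y x + Y y) =
      (Y (c *: x + y) - Yn n (c *: x + y)) - c *: (Y x - Yn n x) - (Y y - Yn n y).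
    rewrite ln scalerBr -!addrA -!opprD; congr (_ - _).
    by rewrite [X in _ = _ + X]addrACA -opprD [RHS]addrC subrK.
  apply: le_trans (ler_rnormD _ _) _; rewrite rnormN /K 2!mulrDr lerD //.
  apply: le_trans (ler_rnormD _ _) _; rewrite rnormN lerD //.
  by rewrite rnormZ mulrCA ler_wpM2l.
have hrip x y : rip (Y x) y = rip x (Y y).
  apply/eqP; rewrite -subr_eq0 -normr_eq0; apply/eqP.
  apply: (@le_small_eq0 _ _ (2 * (rnorm x * rnorm y))) => [||e e0] //.
    by rewrite !mulr_ge0 ?rnorm_ge0.
  have [n hn] := hlim _ e0; have [_ _ _ sn _] := dn n.
  have -> : rip (Y x) y - rip x (Y y) = rip (Y x - Yn n x) y - rip x (Y y - Yn n y).
    by rewrite ripBl ripBr (adjoint_pair_rip _ _ sn); lra.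
  apply: le_trans (ler_normB _ _) _.
  have h1 : `|rip (Y x - Yn n x) y| <= e * rnorm x * rnorm y.
    by apply: le_trans (rip_CS hip _ _) _; rewrite ler_wpM2r ?rnorm_ge0.
  have h2 : `|rip x (Y y - Yn n y)| <= rnorm x * (e * rnorm y).
    by apply: le_trans (rip_CS hip _ _) _; rewrite ler_wpM2l ?rnorm_ge0.
  lra.
split=> //; first exact: rip_ip.
move=> Z bZ cZ x; have [M [M0 hM]] := bounded_operator_pos bZ.
apply/subr0_eq/(@rnorm_small_eq0 _ (M * rnorm x + rnorm (Z x))) => [|e e0].
  by rewrite addr_ge0 ?mulr_ge0 ?rnorm_ge0 ?ltW.
have [n hn] := hlim _ e0; have [_ _ _ _ cn] := dn n.
have -> : Z (Y x) - Y (Z x) = Z (Y x - Yn n x) - (Y (Z x) - Yn n (Z x)).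
  by rewrite (linear_sub bZ.1) cn // opprB addrA subrK.
apply: le_trans (ler_rnormD _ _) _; rewrite rnormN mulrDr lerD //.
by apply: le_trans (hM _) _; rewrite mulrCA ler_pM2l.
Qed.

Fixpoint sqrt_iter Q n : H -> H := if n is n'.+1 then
  fun x => (2^-1)%:C *: (Q x + sqrt_iter Q n' (sqrt_iter Q n' x)) else fun=> 0.

(** The value [p_n(1)], where [p_n] is the polynomial with [sqrt_iter Q n = p_n(Q)]. *)
Fixpoint sqrt_iter_bound n : R := if n is n'.+1 then
  2^-1 * (1 + sqrt_iter_bound n' * sqrt_iter_bound n') else 0.

Lemma sqrt_iter_bound_itv n : 0 <= sqrt_iter_bound n <= 1.
Proof. by elim: n => [|n /andP[h0 h1]] /=; [lra|nra]. Qed.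

Section Iteration.
Variable Q : H -> H.
Hypothesis dQ : dominated Q Q 1.
Let bQ := dominated_bounded dQ.

Lemma dominated_sqrt_iter n : dominated Q (sqrt_iter Q n) (sqrt_iter_bound n).
Proof.
elim: n => [|n IH]; first exact: dominated0 bQ.1.
apply: dominatedZ; first by rewrite invr_ge0.
exact: dominatedD dQ (dominatedM bQ IH IH).
Qed.

(** By commutation, [Y_(n+2) - Y_(n+1) = (Y_(n+1) - Y_n) (Y_(n+1) + Y_n) / 2], a product of
    dominated operators. *)
Lemma dominated_sqrt_iterS n :
  dominated Q (fun x => sqrt_iter Q n.+1 x - sqrt_iter Q n x)
    (sqrt_iter_bound n.+1 - sqrt_iter_bound n).
Proof.
have h2 : 0 <= 2^-1 :> R by rewrite invr_ge0.
elim: n => [|n IH].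
  apply: dominated_ext (dominated_sqrt_iter 1) => [x|]; by rewrite subr0.
have dn := dominated_sqrt_iter n; have dn1 := dominated_sqrt_iter n.+1.
apply: dominated_ext (dominatedZ h2 (dominatedM bQ IH (dominatedD dn1 dn))).
  move=> x.
  rewrite -[sqrt_iter Q n.+2 x]/(_ *: (Q x + sqrt_iter Q n.+1 (sqrt_iter Q n.+1 x))).
  rewrite -[X in _ = _ - X]/(_ *: (Q x + sqrt_iter Q n (sqrt_iter Q n x))).
  rewrite -scalerBr; congr (_ *: _).
  have cn := dominated_comm bQ dn1 dn x.
  case: dn dn1 => [ln _ _ _ _] [ln1 _ _ _ _].
  rewrite /comp (linear_add ln1) (linear_add ln) cn.
  by rewrite addrKA opprD addrACA subrr add0r.
rewrite -[X in _ = X - _]/(2^-1 * (1 + sqrt_iter_bound n.+1 * sqrt_iter_bound n.+1)).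
by rewrite -[X in _ = _ - X]/(2^-1 * (1 + sqrt_iter_bound n * sqrt_iter_bound n)); ring.
Qed.

Lemma dominated_sqrt_iterD n k :
  dominated Q (fun x => sqrt_iter Q (n + k) x - sqrt_iter Q n x)
    (sqrt_iter_bound (n + k) - sqrt_iter_bound n).
Proof.
elim: k => [|k IH].
  apply: dominated_ext (dominated0 bQ.1) => [x|]; by rewrite addn0 subrr.
rewrite addnS; apply: dominated_ext (dominatedD (dominated_sqrt_iterS (n + k)) IH).
  by move=> x; rewrite subrKA.
by rewrite subrKA.
Qed.

(** The scalars [sqrt_iter_bound n] increase to their supremum [s], and [s - sqrt_iter_bound n]
    bounds the norm of every tail [Y_(n+k) - Y_n]. Hence the iterates converge in operator norm, and
    the recursion passes to the limit. *)
Lemma sqrt_iter_limit : exists2 Y, dominated Q Y 1 &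
  forall x, Y x = (2^-1)%:C *: (Q x + Y (Y x)).
Proof.
pose E := [set sqrt_iter_bound n | n in setT]%classic.
have supE : has_sup E.
  split; first by exists (sqrt_iter_bound 0); exists 0%N.
  by exists 1 => _ [n _ <-]; have /andP[] := sqrt_iter_bound_itv n.
pose s := sup E.
have bs n : sqrt_iter_bound n <= s by apply: sup_upper_bound => //; exists n.
have cs e : 0 < e -> exists n, s - sqrt_iter_bound n < e.
  move=> e0; have [_ [n _ <-] h] := sup_adherent e0 supE.
  by exists n; move: h; rewrite -/s; lra.
have hd n k x : rnorm (sqrt_iter Q (n + k) x - sqrt_iter Q n x) <=
    (s - sqrt_iter_bound n) * rnorm x.
  have [_ _ h _ _] := dominated_sqrt_iterD n k; apply: le_trans (h x) _.
  by rewrite ler_wpM2r ?rnorm_ge0 // lerD2r.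
have hc x : exists l, converges_to (fun n => sqrt_iter Q n x) l.
  apply: cauchy_converges => e e0.
  have K1 : 0 < 2 * (rnorm x + 1) by rewrite mulr_gt0 // ltr_wpDl ?rnorm_ge0.
  have [N hN] := cs _ (divr_gt0 e0 K1); exists N => i j /subnKC <- /subnKC <-.
  set a := (i - N)%N; set b := (j - N)%N.
  rewrite -[X in X - _](subrK (sqrt_iter Q N x)) -addrA.
  apply: le_lt_trans (ler_rnormD _ _) _; rewrite [X in _ + X]rnormB.
  have := hd N a x; have := hd N b x; move: hN; rewrite ltr_pdivlMr //.
  have := bs N; have := rnorm_ge0 x; nra.
have [Y hY] := choice hc.
have lim n x : rnorm (Y x - sqrt_iter Q n x) <= (s - sqrt_iter_bound n) * rnorm x.
  apply/ler_addgt0Pr => e e0; have [N hN] := hY x _ e0.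
  have := hN (n + N)%N (leq_addl _ _) => /ltW; rewrite rnormB => h.
  rewrite -[Y x](subrK (sqrt_iter Q (n + N) x)) -addrA.
  by rewrite (le_trans (ler_rnormD _ _)) // [leRHS]addrC (lerD h (hd n N x)).
have limY e : 0 < e ->
    exists n, forall x, rnorm (Y x - sqrt_iter Q n x) <= e * rnorm x.
  move=> /cs [n hn]; exists n => x; apply: le_trans (lim n x) _.
  by rewrite ler_wpM2r ?rnorm_ge0 // ltW.
have dY : dominated Q Y 1.
  apply: dominated_lim dominated_sqrt_iter _ limY => n.
  by have /andP[] := sqrt_iter_bound_itv n.
exists Y => // x; apply/subr0_eq/(@rnorm_small_eq0 _ (2 * rnorm x)) => [|e e0].
  by rewrite mulr_ge0 ?rnorm_ge0.
have [n hn] := cs _ e0.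
(* The defect of the fixed-point equation is compared with the recursion from [n] to [n.+1]: [e |x|]
   comes from the left side and half of [2 e |x|] from the squared term. *)
have ha : rnorm (Y x - sqrt_iter Q n.+1 x) <= e * rnorm x.
  apply: le_trans (lim _ _) _; rewrite ler_wpM2r ?rnorm_ge0 //.
  have [_ h _ _ _] := dominated_sqrt_iterS n; lra.
have [ln _ bn _ _] := dominated_sqrt_iter n; have [lY _ bY _ _] := dY.
have hb : rnorm (Y x - sqrt_iter Q n x) <= e * rnorm x.
  by apply: le_trans (lim _ _) _; rewrite ler_wpM2r ?rnorm_ge0 // ltW.
have hyy : rnorm (sqrt_iter Q n (sqrt_iter Q n x) - Y (Y x)) <= 2 * (e * rnorm x).
  rewrite -[X in X - _](subrK (Y (sqrt_iter Q n x))) -addrA -(linear_sub lY).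
  apply: le_trans (ler_rnormD _ _) _; rewrite rnormB.
  have := bY (sqrt_iter Q n x - Y x); rewrite mul1r rnormB => h1.
  have h2 : rnorm (Y (sqrt_iter Q n x) - sqrt_iter Q n (sqrt_iter Q n x))
      <= e * rnorm x.
    apply: le_trans (lim _ _) _; apply: ler_pM => //; rewrite ?rnorm_ge0 ?subr_ge0 //.
    - exact: ltW.
    - apply: le_trans (bn _) _; rewrite ler_piMl ?rnorm_ge0 //.
      by have /andP[] := sqrt_iter_bound_itv n.
  lra.
have -> : Y x - (2^-1)%:C *: (Q x + Y (Y x)) = (Y x - sqrt_iter Q n.+1 x) +
    (2^-1)%:C *: (sqrt_iter Q n (sqrt_iter Q n x) - Y (Y x)).
  rewrite /= -[RHS]addrA -!scalerN -scalerDr; congr (_ + _ *: _).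
  by rewrite !opprD -addrA addKr.
apply: le_trans (ler_rnormD _ _) _; rewrite rnormZr ?invr_ge0 //; lra.
Qed.
End Iteration.
End SquareRoot.

(** * Square roots, mixed Schwarz and Buzano inequalities *)

Lemma Re_normM (R : realType) (z w : R[i]) :
  complex.Re `|z * w| = complex.Re `|z| * complex.Re `|w|.
Proof.
rewrite normrM -{1}[`|z|](RRe_real (normr_real z)).
by case: `|w| => u v; rewrite [LHS]/= mul0r subr0.
Qed.

Section MixedSchwarz.
Variables (R : realType) (H : completeNormedModType R[i]).
Variable ip : {dot H for Num.conj}.
Hypothesis hip : hilbert_inner_product ip.
Implicit Types (x y z : H) (S T A B Z : H -> H).
Local Notation rip := (re_ip ip).
Local Notation adjoint_pair := (adjoint_pair ip).
Local Notation dominated := (dominated ip).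

(** With [Q = 1 - A / M], the fixed point satisfies [Y^2 = 2 Y - Q], so [(1 - Y)^2 = 1 - Q = A / M].
    The commutation clause is what [sylvester_sqrt] requires of the root. *)
Lemma positive_sqrt A : positive_operator ip A -> exists S,
  [/\ positive_operator ip S, (forall x, S (S x) = A x) &
    forall Z, bounded_operator Z -> (forall x, Z (A x) = A (Z x)) ->
      forall x, Z (S x) = S (Z x)].
Proof.
move=> pA; have bA := pA.1; have lA := bA.1; have sA := positive_selfadjoint pA.
have [M [M0 hM]] := bounded_operator_pos bA.
have Mi0 : 0 <= M^-1 by rewrite invr_ge0 ltW.
pose Q x := x - (M^-1)%:C *: A x.
have lQ : linear Q.
  by apply: linear_subf; [move=> c x y|exact: linear_scalef].
(* [|Q x|^2 = |x|^2 - 2 <A x, x> / M + |A x|^2 / M^2], and [positive_norm_le] bounds the last term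
   by [<A x, x> / M]. *)
have bQ x : rnorm (Q x) <= rnorm x.
  rewrite -ler_sqr ?nnegrE ?rnorm_ge0 // /Q (rnormD2 hip) rnormN rnormZr //.
  rewrite ripNr ripZr (ripC _ x) exprMn.
  have := positive_norm_le hip x pA M0 hM; set u := rnorm (A x) ^+ 2.
  rewrite mulrC -ler_pdivrMr // mulrC => h.
  have : M^-1 ^+ 2 * u <= M^-1 * rip (A x) x.
    by rewrite expr2 -mulrA ler_wpM2l.
  have : 0 <= M^-1 * rip (A x) x by rewrite mulr_ge0 // (positive_rip_ge0 x pA).
  lra.
have sQ : adjoint_pair Q Q.
  by move=> x y; rewrite /Q ipDl ipDr ipNl ipNr ipZl ipZr sA conjc_real.
have [Y dY hY] := sqrt_iter_limit hip (dominatedX lQ bQ sQ).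
case: (dY) => lY _ bY sY cY.
have YY x : Y (Y x) = Y x + Y x - Q x.
  have h : Y x + Y x = Q x + Y (Y x).
    rewrite {1 2}hY -scalerDl -rmorphD /= (_ : 2^-1 + 2^-1 = 1 :> R) ?scale1r //.
    lra.
  by rewrite h [X in X - _]addrC addrK.
pose m := Num.sqrt M; have m0 : 0 <= m := sqrtr_ge0 M.
pose S x := m%:C *: (x - Y x).
have lS : linear S.
  by apply/linear_scalef/linear_subf => //; move=> c x y.
have SS x : S (S x) = A x.
  rewrite /S (scalable_linear lY) -scalerBr scalerA -rmorphM /= -expr2.
  rewrite sqr_sqrtr ?ltW // (linear_sub lY) YY.
  have -> : x - Y x - (Y x - (Y x + Y x - Q x)) = x - Q x.
    by rewrite opprB [X in _ + X]addrAC addrK subrKA.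
  rewrite /Q opprB addrC subrK scalerA -rmorphM /= divff ?scale1r //.
  by rewrite gt_eqF.
exists S; split=> //.
- apply: selfadjoint_rip_ge0_positive.
  + split=> //; exists (m * 2) => x; rewrite /S rnormZr // -mulrA ler_wpM2l //.
    apply: le_trans (ler_rnormD _ _) _; rewrite rnormN.
    by have := bY x; lra.
  + by move=> x y; rewrite /S ipZl ipZr conjc_real !(ipDl, ipDr, ipNl, ipNr) sY.
  + move=> x; rewrite /S ripZl mulr_ge0 // ripBl (ripxx hip) subr_ge0.
    apply: le_trans (rip_le hip _ _) _; rewrite expr2 ler_wpM2r ?rnorm_ge0 //.
    by have := bY x; rewrite mul1r.
- move=> Z bZ cZ x; rewrite /S (scalable_linear bZ.1) /= (linear_sub bZ.1) cY //.
  move=> {}x; rewrite /Q (linear_sub bZ.1) (scalable_linear bZ.1) /= cZ //.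
Qed.

(* With [D = T A - B T] the hypothesis reads [B D = - D A]. Hence [D^* D]
   commutes with [A], so with its square root [S], and
   [|D S x|^2 = <D^* D A x, x> = - <B D x, D x> <= 0]. *)
Lemma sylvester_sqrt A B T Ts : positive_operator ip A -> positive_operator ip B ->
  bounded_operator T -> adjoint_pair T Ts ->
  (forall x, T (A (A x)) = B (B (T x))) -> forall x, T (A x) = B (T x).
Proof.
move=> pA pB bT aT hT.
have bA := pA.1; have bB := pB.1; have bTs := adjoint_pair_bounded hip aT bT.
have lA := bA.1; have lB := bB.1; have lT := bT.1; have lTs := bTs.1.
have sA := positive_selfadjoint pA; have sB := positive_selfadjoint pB.
have [S [pS SS cS]] := positive_sqrt pA; have sS := positive_selfadjoint pS.
pose D x := T (A x) - B (T x); pose Ds x := A (Ts x) - Ts (B x).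
have aD : adjoint_pair D Ds.
  by move=> x y; rewrite /D /Ds !(ipDl, ipDr, ipNl, ipNr) aT sA sB aT.
have bD : bounded_operator D.
  by apply: bounded_addf; [|apply: bounded_oppf]; exact: bounded_comp.
have bDs := adjoint_pair_bounded hip aD bD.
have lD := bD.1; have lDs := bDs.1.
have BD x : B (D x) = - D (A x).
  by rewrite /D (linear_sub lB) -hT opprB.
have DsB x : Ds (B x) = - A (Ds x).
  apply: (ip_extC hip) => z.
  by rewrite -aD -sB BD ipNl aD ipNr sA.
have bE : bounded_operator (Ds \o D) by exact: bounded_comp.
have cE x : Ds (D (A x)) = A (Ds (D x)).
  by rewrite -[D (A x)]opprK -BD (linear_applyN _ lDs) DsB opprK.
have key x : rnorm (D (S x)) ^+ 2 + rip (B (D x)) (D x) = 0.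
  rewrite -(ripxx hip) (adjoint_pair_rip _ _ aD).
  have -> : Ds (D (S x)) = S (Ds (D x)) by exact: cS bE cE x.
  rewrite (adjoint_pair_rip _ _ sS) SS -cE -(adjoint_pair_rip _ _ aD).
  by rewrite ripC -ripDl BD subrr rip0l.
have BDge x : 0 <= rip (B (D x)) (D x) by exact: positive_rip_ge0.
(* Both terms of [key] are nonnegative, so [<B D x, D x> = 0]; Cauchy-Schwarz for [B] then kills
   [B D x]. *)
have BD0 x : B (D x) = 0.
  apply/(rnorm0_eq0)/eqP; rewrite -sqrf_eq0 -(ripxx hip) -sqrf_eq0.
  rewrite eq_le sqr_ge0 andbT; apply: le_trans (positive_CS _ _ pB) _.
  have -> : rip (B (D x)) (D x) = 0.
    have := key x; have := BDge x; have := sqr_ge0 (rnorm (D (S x))); lra.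
  by rewrite mul0r.
(* [|D^* D x|^2 = <D D^* D x, D x>]. Here [A D^* D x = D^* D A x = - D^* B D x = 0], and the
   remaining term of [D] pairs with [B D x = 0]. *)
have E0 x : Ds (D x) = 0.
  apply/(rnorm0_eq0)/eqP; rewrite -sqrf_eq0 -(ripxx hip).
  rewrite -(adjoint_pair_rip _ _ aD).
  have -> : D (Ds (D x)) = T (A (Ds (D x))) - B (T (Ds (D x))) by [].
  rewrite -cE -[D (A x)]opprK -BD BD0 oppr0 (linear_apply0 lDs).
  by rewrite (linear_apply0 lT) sub0r ripNl (adjoint_pair_rip _ _ sB) BD0
    rip0r oppr0.
move=> x; apply/subr0_eq/(rnorm0_eq0)/eqP; rewrite -sqrf_eq0 -(ripxx hip).
by rewrite -/(D x) (adjoint_pair_rip _ _ aD) E0 rip0r.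
Qed.

(* For [v = S u] one has [T v = S' (T u)] and [|T u| = |A u| = |S v|], so
   [<T v, y> = <T u, S' y>] is at most [|S v| |S' y|]; the vectors orthogonal
   to the range of [S] are in the kernels of both [S] and [T]. *)
Lemma mixed_schwarz_rip T Ts A B : bounded_operator T -> adjoint_pair T Ts ->
  positive_operator ip A -> positive_operator ip B ->
  (forall x, A (A x) = Ts (T x)) -> (forall x, B (B x) = T (Ts x)) ->
  forall x y, rip (T x) y ^+ 2 <= rip (A x) x * rip (B y) y.
Proof.
move=> bT aT pA pB AA BB x y.
have bTs := adjoint_pair_bounded hip aT bT; have lT := bT.1.
have sA := positive_selfadjoint pA.
have [S [pS SS _]] := positive_sqrt pA; have [S' [pS' SS' _]] := positive_sqrt pB.
have sS := positive_selfadjoint pS; have sS' := positive_selfadjoint pS'.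
have lS := pS.1.1; have lA := pA.1.1.
(* Two uses of [sylvester_sqrt]: [T A^2 = T T^* T = B^2 T] gives [T A = B T], which in turn gives
   [T S = S' T]. *)
have TS : forall u, T (S u) = S' (T u).
  apply: (sylvester_sqrt pS pS' bT aT) => u; rewrite SS SS'.
  by apply: (sylvester_sqrt pA pB bT aT) => {}u; rewrite AA BB.
have normT u : rnorm (T u) = rnorm (A u).
  apply/eqP; rewrite -(@eqrXn2 _ 2) ?rnorm_ge0 // -!(ripxx hip).
  by rewrite (adjoint_pair_rip _ _ aT) -AA -(adjoint_pair_rip _ _ sA).
have rA u : rip (A u) u = rnorm (S u) ^+ 2.
  by rewrite -SS (adjoint_pair_rip _ _ sS) (ripxx hip).
have rB u : rip (B u) u = rnorm (S' u) ^+ 2.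
  by rewrite -SS' (adjoint_pair_rip _ _ sS') (ripxx hip).
(* [z] is the projection of [x] onto the closure of the range of [S], approached by points [u n] of
   that range. *)
have [||||||u [z [Vu uz hz]]] := @riesz_on_subspace _ _ ip hip
  (fun v => exists w, v = S w) (fun v => rip v x) (rnorm x).
- by exists 0; rewrite (linear_apply0 lS).
- by move=> _ _ [v ->] [w ->]; exists (v + w); rewrite (linear_add lS).
- by move=> a _ [v ->]; exists (a%:C *: v); rewrite (scalable_linear lS).
- by move=> v w; rewrite ripDl.
- by move=> a v; rewrite ripZl.
- by move=> v; rewrite mulrC rip_CS.
have Sxz : S x = S z.
  apply/subr0_eq/(rnorm0_eq0)/eqP; rewrite -(linear_sub lS) -sqrf_eq0.
  rewrite -(ripxx hip) (adjoint_pair_rip _ _ sS) ripBl subr_eq0.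
  apply/eqP; rewrite [RHS]hz; last by exists (S (x - z)).
  by rewrite [LHS]ripC.
have Txz : T x = T z.
  apply/subr0_eq/(rnorm0_eq0); rewrite -(linear_sub lT) normT -SS (linear_sub lS).
  by rewrite Sxz subrr (linear_apply0 lS) rnorm0.
have hV v : (exists w, v = S w) -> `|rip (T v) y| <= rnorm (S v) * rnorm (S' y).
  move=> [w ->]; rewrite TS (adjoint_pair_rip _ _ sS') SS -normT.
  exact: rip_CS.
rewrite rA rB -exprMn -[leLHS]real_normK ?num_real //.
rewrite ler_sqr ?nnegrE ?normr_ge0 ?mulr_ge0 ?rnorm_ge0 // Sxz Txz.
have [M [M0 hM]] := bounded_operator_pos bT.
have [N [N0 hN]] := bounded_operator_pos pS.1.
apply/ler_addgt0Pr => e e0.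
(* Replacing [z] by [u n] costs [M |y|] through [T] and [N |S' y|] through [S], per unit of
   distance; the [1] keeps the divisor positive. *)
have K0 : 0 < M * rnorm y + N * rnorm (S' y) + 1.
  by rewrite ltr_wpDl ?addr_ge0 ?mulr_ge0 ?rnorm_ge0 ?ltW.
have [n /(_ n (leqnn n)) /ltW] := uz _ (divr_gt0 e0 K0).
rewrite ler_pdivlMr // => h.
have h1 : `|rip (T z - T (u n)) y| <= M * rnorm (u n - z) * rnorm y.
  apply: le_trans (rip_CS hip _ _) _; rewrite -(linear_sub lT) [in leRHS]rnormB.
  by rewrite ler_wpM2r ?rnorm_ge0.
have h2 : rnorm (S (u n)) <= rnorm (S z) + N * rnorm (u n - z).
  rewrite -[u n](subrK z) (linear_add lS) addrC (le_trans (ler_rnormD _ _)) //.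
  by rewrite addrK lerD2l.
have h3 := hV _ (Vu n).
have -> : rip (T z) y = rip (T z - T (u n)) y + rip (T (u n)) y.
  by rewrite ripBl subrK.
apply: le_trans (ler_normD _ _) _.
have h4 : rnorm (S (u n)) * rnorm (S' y) <=
    (rnorm (S z) + N * rnorm (u n - z)) * rnorm (S' y).
  by rewrite ler_wpM2r ?rnorm_ge0.
have := rnorm_ge0 (u n - z); lra.
Qed.

(** Rotating [x] by a unimodular scalar leaves [<A x, x>] unchanged, so the real version
    suffices. *)
Lemma mixed_schwarz T Ts A B : bounded_operator T -> adjoint_pair T Ts ->
  positive_operator ip A -> positive_operator ip B ->
  (forall x, A (A x) = Ts (T x)) -> (forall x, B (B x) = T (Ts x)) ->
  forall x y, complex.Re `|ip (T x) y| ^+ 2 <= rip (A x) x * rip (B y) y.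
Proof.
move=> bT aT pA pB AA BB x y; have [c [c1 ->]] := ip_rotate ip (T x) y.
rewrite -(scalable_linear bT.1).
have -> : rip (A x) x = rip (A (c *: x)) (c *: x).
  rewrite /re_ip (scalable_linear pA.1.1) ipZl ipZr mulrA -sqr_normc c1.
  by rewrite expr1n mul1r.
exact: mixed_schwarz_rip.
Qed.

(* [2 <b, x> x - b] is a reflection of [b], of the same norm as [b]. *)
Lemma buzano a b x : rnorm x = 1 ->
  2 * (complex.Re `|ip a x| * complex.Re `|ip x b|) <=
  rnorm a * rnorm b + complex.Re `|ip a b|.
Proof.
move=> x1; pose w := ip b x; pose r := (2%:C * w) *: x - b.
have wE : ip x b = (w^*)%C by rewrite ipC.
have rb : rnorm r = rnorm b.
  apply/eqP; rewrite -(@eqrXn2 _ 2) ?rnorm_ge0 // -!(ripxx hip) /re_ip /r.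
  rewrite !(ipDl, ipDr, ipNl, ipNr, ipZl, ipZr) -/w wE (ip_rnorm hip x) x1.
  by move: (w) (ip b b) => [u v] [p q] /=; apply/eqP; ring.
have arE : ip a r = 2%:C * (ip a x * ip x b) - ip a b.
  rewrite /r ipDr ipNr ipZr wE rmorphM /= oppr0.
  by rewrite -mulrA [_ * ip a x]mulrC.
(* Cauchy-Schwarz bounds [|2 <a, x> <x, b> - <a, b>|] by [|a| |b|]; the triangle inequality restores
   [<a, b>]. *)
have := ip_CS hip a r; rewrite rb arE.
have -> : 2 * (complex.Re `|ip a x| * complex.Re `|ip x b|)
    = complex.Re `|2%:C * (ip a x * ip x b)|.
  by rewrite Re_normM Re_normM (ger0_norm (x := 2%:C)) ?ler0c ?ler0n.
move=> h; rewrite -[X in `|X|](subrK (ip a b)).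
have : complex.Re `|2%:C * (ip a x * ip x b) - ip a b + ip a b| <=
   complex.Re (`|2%:C * (ip a x * ip x b) - ip a b| + `|ip a b|).
  by have := ler_normD (2%:C * (ip a x * ip x b) - ip a b) (ip a b);
    rewrite lecE => /andP[].
have ReD (z z' : R[i]) : complex.Re (z + z') = complex.Re z + complex.Re z'.
  by case: z z' => ? ? [].
rewrite ReD; lra.
Qed.
End MixedSchwarz.

(** * Numerical radius and operator norm estimates *)

Section NumericalRadius.
Variables (R : realType) (H : completeNormedModType R[i]).
Variable ip : {dot H for Num.conj}.
Hypothesis hip : hilbert_inner_product ip.
Implicit Types (x y z : H) (S T A B Z : H -> H).
Local Notation rip := (re_ip ip).
Local Notation adjoint_pair := (adjoint_pair ip).

Lemma adjointK T : bounded_operator T -> adjoint ip (adjoint ip T) = T.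
Proof.
move=> bT; have [bTs aT] := adjointP hip bT; have [_ aTs] := adjointP hip bTs.
apply/funext => x; apply: (ip_extC hip) => z.
by rewrite -aTs (adjoint_pairC aT).
Qed.

(** [T^* T] is positive, so [positive_sqrt] excludes the default value of [xget]. *)
Lemma abs_operatorP T : bounded_operator T ->
  positive_operator ip (abs_operator ip T) /\
  abs_operator ip T \o abs_operator ip T = adjoint ip T \o T.
Proof.
move=> bT; have [bTs aT] := adjointP hip bT.
have pTT : positive_operator ip (adjoint ip T \o T).
  split=> [|x]; first exact: bounded_comp.
  by rewrite /= (adjoint_pairC aT) (ip_rnorm hip) ler0c sqr_ge0.
have [S [pS SS _]] := positive_sqrt hip pTT.
rewrite /abs_operator /sqrt_operator; case: xgetP => [A -> //|/(_ S) []].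
by split=> //; apply/funext.
Qed.

Lemma le_numerical_radius T x : bounded_operator T -> rnorm x = 1 ->
  complex.Re `|ip (T x) x| <= numerical_radius ip T.
Proof.
move=> bT x1; apply: sup_upper_bound; last by exists x.
split; first by exists (complex.Re `|ip (T x) x|), x.
have [M [_ hM]] := bounded_operator_pos bT; exists M => _ [y /= y1 <-].
by apply: le_trans (ip_CS hip _ _) _; have := hM y; rewrite y1 !mulr1.
Qed.

Lemma Re_norm_ge0 (c : R[i]) : 0 <= complex.Re `|c|.
Proof. by have := normr_ge0 c; rewrite lecE => /andP[]. Qed.

Lemma le_Re_norm (c : R[i]) : complex.Re c <= complex.Re `|c|.
Proof.
apply: le_trans (ler_norm _) _.
by have := normc_ge_Re c; rewrite lecE => /andP[].
Qed.

(** The assumption [0 <= c] covers the zero space, where the supremum of the empty set is [0]. *)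
Lemma numerical_radius_le T (c : R) : 0 <= c ->
  (forall x, rnorm x = 1 -> complex.Re `|ip (T x) x| <= c) ->
  numerical_radius ip T <= c.
Proof.
move=> c0 h; rewrite /numerical_radius; set E := (X in sup X).
have [->|/set0P E0] := eqVneq E set0; first by rewrite sup0.
by apply: ge_sup => // _ [x /= x1 <-]; exact: h.
Qed.

Lemma numerical_radius_ge0 T : bounded_operator T -> 0 <= numerical_radius ip T.
Proof.
move=> bT; have [[x x1]|n1] := pselect (exists x : H, rnorm x = 1).
  exact: le_trans (Re_norm_ge0 _) (le_numerical_radius bT x1).
rewrite /numerical_radius (_ : mkset _ = set0) ?image_set0 ?sup0 //.
by apply/seteqP; split=> // x x1; apply: n1; exists x.
Qed.

Lemma le_operator_norm T x : bounded_operator T -> rnorm x <= 1 ->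
  rnorm (T x) <= operator_norm T.
Proof.
move=> bT x1; apply: sup_upper_bound; last by exists x.
split; first by exists (rnorm (T x)), x.
have [M [M0 hM]] := bounded_operator_pos bT; exists M => _ [y /= y1 <-].
by apply: le_trans (hM _) _; rewrite ler_piMr // ltW.
Qed.

Lemma operator_norm_ge0 T : bounded_operator T -> 0 <= operator_norm T.
Proof.
move=> bT; apply: le_trans (rnorm_ge0 _) (@le_operator_norm T 0 bT _).
by rewrite rnorm0.
Qed.

(** The supremum is taken before squaring, so the pointwise bound is first moved under a square
    root. *)
Lemma numerical_radius_sqr_le T (a b : R) : 0 <= a + b ->
  bounded_operator T ->
  (forall x, rnorm x = 1 -> 2 * complex.Re `|ip (T x) x| ^+ 2 <= a + b) ->
  numerical_radius ip T ^+ 2 <= 2^-1 * a + 2^-1 * b.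
Proof.
move=> ab0 bT h; rewrite -mulrDr -[leRHS]sqr_sqrtr ?mulr_ge0 ?invr_ge0 //.
rewrite ler_sqr ?nnegrE ?sqrtr_ge0 ?numerical_radius_ge0 //.
apply: numerical_radius_le => [|x x1]; first exact: sqrtr_ge0.
rewrite -ler_sqr ?nnegrE ?sqrtr_ge0 ?Re_norm_ge0 //.
rewrite sqr_sqrtr ?mulr_ge0 ?invr_ge0 //; have := h x x1; lra.
Qed.

Lemma numerical_radius_sqr_bounds T : bounded_operator T ->
  let Ts := adjoint ip T in
  let A := abs_operator ip T in
  let B := abs_operator ip Ts in
  let N := 2^-1 * operator_norm ((A \o A) \+ (B \o B)) in
  [/\ 0 <= N, bounded_operator (A \o B),
    numerical_radius ip T ^+ 2 <=
      2^-1 * numerical_radius ip (A \o B) + 2^-1 * N &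
    numerical_radius ip T ^+ 2 <=
      2^-1 * numerical_radius ip (T \o T) + 2^-1 * N].
Proof.
move=> bT Ts A B N; have [bTs aT] := adjointP hip bT.
have [pA AA] := abs_operatorP bT; have [pB BB] := abs_operatorP bTs.
rewrite (adjointK bT) -/Ts -/A -/B in pA AA pB BB bTs aT.
have {}AA x : A (A x) = Ts (T x) by have := congr1 (fun f => f x) AA.
have {}BB x : B (B x) = T (Ts x) by have := congr1 (fun f => f x) BB.
have sA := positive_selfadjoint pA; have sB := positive_selfadjoint pB.
have bAB : bounded_operator (A \o B) by exact: bounded_comp pA.1 pB.1.
have bTT : bounded_operator (T \o T) by exact: bounded_comp.
have bN : bounded_operator ((A \o A) \+ (B \o B)).
  by apply: bounded_addf; [exact: bounded_comp pA.1 pA.1|exact: bounded_comp pB.1 pB.1].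
have N0 : 0 <= N by rewrite mulr_ge0 ?invr_ge0 // operator_norm_ge0.
have nA x : rnorm (A x) = rnorm (T x).
  apply/eqP; rewrite -(@eqrXn2 _ 2) ?rnorm_ge0 // -!(ripxx hip).
  by rewrite (adjoint_pair_rip _ _ aT) -AA (adjoint_pair_rip _ _ sA).
have nB x : rnorm (B x) = rnorm (Ts x).
  apply/eqP; rewrite -(@eqrXn2 _ 2) ?rnorm_ge0 // -!(ripxx hip).
  by rewrite (adjoint_pair_rip _ _ (adjoint_pairC aT)) -BB
    (adjoint_pair_rip _ _ sB).
(* AM-GM, with [|T x|^2 + |T^* x|^2 = <(A^2 + B^2) x, x>]. *)
have hN x : rnorm x = 1 -> rnorm (T x) * rnorm (Ts x) <= N.
  move=> x1; have x1' : rnorm x <= 1 by rewrite x1.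
  have := le_operator_norm bN x1'; have := rip_le hip (A (A x) + B (B x)) x.
  rewrite x1 mulr1 ripDl (adjoint_pair_rip _ _ sA) (adjoint_pair_rip _ _ sB).
  rewrite !(ripxx hip) nA nB /N /=.
  have := sqr_ge0 (rnorm (T x) - rnorm (Ts x)); rewrite sqrrB; lra.
split=> //.
- apply: numerical_radius_sqr_le => //.
    by rewrite addr_ge0 ?numerical_radius_ge0.
  move=> x x1; have := buzano hip (A x) (B x) x1; rewrite nA nB.
  have := hN x x1; have := le_numerical_radius bAB x1.
  (* [<A B x, x> = <B x, A x>] is the conjugate of [<A x, B x>]. *)
  have -> : complex.Re `|ip ((A \o B) x) x| = complex.Re `|ip (A x) (B x)|.
    by rewrite -[(A \o B) x]/(A (B x)) sA ipC normcJ.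
  have := mixed_schwarz hip bT aT pA pB AA BB x x.
  have hAx : rip (A x) x <= complex.Re `|ip (A x) x|.
    exact: le_Re_norm.
  have hBx : rip (B x) x <= complex.Re `|ip x (B x)|.
    by rewrite ripC; exact: le_Re_norm.
  have : rip (A x) x * rip (B x) x <=
      complex.Re `|ip (A x) x| * complex.Re `|ip x (B x)|.
    by apply: ler_pM => //; exact: positive_rip_ge0.
  lra.
- apply: numerical_radius_sqr_le => //.
    by rewrite addr_ge0 ?numerical_radius_ge0.
  move=> x x1; have := buzano hip (T x) (Ts x) x1.
  have := hN x x1; have := le_numerical_radius bTT x1.
  by rewrite -!aT -expr2 /=; lra.
Qed.
End NumericalRadius.

(** * Convexity of Orlicz functions and conclusion *)

Lemma orlicz_midpoint (R : realType) (phi : R -> R) (a b : R) :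
  orlicz_function phi -> 0 <= a -> 0 <= b ->
  phi (2^-1 * a + 2^-1 * b) <= 2^-1 * phi a + 2^-1 * phi b.
Proof.
move=> hphi a0 b0.
have h0 : 0 <= (2^-1 : R) by rewrite invr_ge0.
have h1 : (2^-1 : R) <= 1 by lra.
have := orlicz_convex hphi (@Itv01 R (2^-1) h0 h1) (x := a) (y := b).
rewrite !inE /= !in_itv /= !andbT => /(_ a0 b0).
have half : unstable.onem (2^-1 : R) = 2^-1 by rewrite /unstable.onem; lra.
rewrite convRE /= half; congr (phi _ <= _).
by rewrite -[LHS]/(2^-1 * a + unstable.onem 2^-1 * b) half.
Qed.

Theorem theorem2p24 (R : realType) (H : completeNormedModType R[i])
    (ip : {dot H for Num.conj}) (T : H -> H) (phi : R -> R)
    (hip : hilbert_inner_product ip)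
    (hT : bounded_operator T)
    (hphi : orlicz_function phi) :
  let Ts := adjoint ip T in
  let absT := abs_operator ip T in
  let absTs := abs_operator ip Ts in
  phi (numerical_radius ip T ^+ 2) <=
    2^-1 * Num.min (phi (numerical_radius ip (absT \o absTs)))
                    (phi (numerical_radius ip (T \o T)))
    + 2^-1 * phi (2^-1 * operator_norm
                             ((absT \o absT) \+ (absTs \o absTs))).
Proof.
cbv zeta; have [N0 bAB wAB wTT] := numerical_radius_sqr_bounds hip hT.
have phi_le (a b c : R) : 0 <= a -> 0 <= b -> 0 <= c ->
    c <= 2^-1 * a + 2^-1 * b -> phi c <= 2^-1 * phi a + 2^-1 * phi b.
  move=> a0 b0 c0 hc; apply: le_trans (orlicz_midpoint hphi a0 b0).
  apply: (orlicz_increasing hphi) => //; rewrite in_itv /= andbT //.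
  exact: le_trans hc.
(* The minimum is one of its two arguments, and each case uses the corresponding bound on the
   squared numerical radius. *)
by rewrite minEle; case: ifP => _; apply: phi_le; rewrite ?sqr_ge0 ?numerical_radius_ge0 //;
  exact: bounded_comp.
Qed.
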